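(* Let $\mathscr{G}$ be Goedgebeur's graph, i.e. the cubic bipartite graph on $30$ vertices defined in the context. Then $$\mathrm{Aut}(\mathscr{G}) \cong (\mathbb{Z}_3 \times \mathbb{Z}_3) \rtimes (D_4 \times \mathbb{Z}_2),$$ where $D_4$ denotes the dihedral group of order $8$; that is, the automorphism group of $\mathscr{G}$ is isomorphic to a semidirect product of $\mathbb{Z}_3 \times \mathbb{Z}_3$ (normal factor) by $D_4 \times \mathbb{Z}_2$, for some homomorphism $D_4\times\mathbb{Z}_2 \to \mathrm{Aut}(\mathbb{Z}_3\times\mathbb{Z}_3)$.
   Context: All graphs are finite, simple and undirected; $\mathrm{Aut}(\mathscr{G})$ is the group of all graph automorphisms of $\mathscr{G}$ (they are allowed to interchange the two sides of the bipartition). The Levi graph of a point-line incidence structure is the bipartite graph whose vertices are the points and the lines, a point being adjacent to a line exactly when they are incident. All indices below are taken modulo $4$. The graph $\mathscr{G}$ is the Levi graph of a $15_3$ configuration $\mathscr{C}$ constructed as follows. (1) $MK$-residue. The Möbius-Kantor configuration $8_3$ has points $P_0,\dots,P_3,P'_0,\dots,P'_3$ and lines $l_i=\{P'_i,P'_{i+1},P_{i+2}\}$ and $l'_i=\{P'_i,P_{i-1},P_i\}$, $i\in\mathbb{Z}/4$ (the two quadrilaterals $P_0P_1P_2P_3$ and $P'_0P'_1P'_2P'_3$ are mutually inscribed and circumscribed). The $MK$-residue is obtained by removing the four incidences $P_i \,|\, l_{i+2}$, $i\in\mathbb{Z}/4$, keeping all points and lines. (2) $F$-residue. The Fano configuration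 $7_3$ has points $P''_0,\dots,P''_3,D_0,D_1,Q$ and lines $l''_0=\{P''_0,P''_1,D_0\}$, $l''_1=\{P''_1,P''_2,D_1\}$, $l''_2=\{P''_2,P''_3,D_0\}$, $l''_3=\{P''_3,P''_0,D_1\}$, $d_0=\{P''_0,P''_2,Q\}$, $d_1=\{P''_1,P''_3,Q\}$, $d=\{D_0,D_1,Q\}$. The $F$-residue is obtained by removing the four incidences $P''_{i+1}\,|\,l''_i$, $i\in\mathbb{Z}/4$, keeping all points and lines. (3) Joining. $\mathscr{C}$ is the disjoint union of the $MK$-residue and the $F$-residue together with the eight additional incidences $P_i\,|\,l''_i$ and $P''_i\,|\,l_i$, $i\in\mathbb{Z}/4$. Explicitly, $\mathscr{G}$ has the $15$ point-vertices $P_i,P'_i,P''_i$ $(i\in\mathbb{Z}/4)$, $D_0,D_1,Q$, the $15$ line-vertices $l_i,l'_i,l''_i$ $(i\in\mathbb{Z}/4)$, $d_0,d_1,d$, and the following $45$ edges given by the neighbourhoods of the line-vertices: $N(l_i)=\{P'_i,P'_{i+1},P''_i\}$ and $N(l'_i)=\{P'_i,P_{i-1},P_i\}$ for $i\in\mathbb{Z}/4$; $N(l''_i)=\{P''_i,P_i,D_0\}$ for $i\in\{0,2\}$; $N(l''_i)=\{P''_i,P_i,D_1\}$ for $i\in\{1,3\}$; $N(d_0)=\{P''_0,P''_2,Q\}$; $N(d_1)=\{P''_1,P''_3,Q\}$; $N(d)=\{D_0,D_1,Q\}$. *)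

(* Defs.v *)
From HB Require Import structures.
From mathcomp Require Import all_boot all_order all_algebra all_fingroup all_solvable.

Set Implicit Arguments.
Unset Strict Implicit.
Unset Printing Implicit Defensive.

Import GRing.Theory.

Section GraphAutomorphisms.
Variables (V : finType) (adj : rel V).

Definition graph_aut : {set {perm V}} :=
  [set s : {perm V} | [forall x, forall y, adj (s x) (s y) == adj x y]].

Lemma graph_aut_group_set : group_set graph_aut.
Proof.
apply/group_setP; split=> [|s t].
  by rewrite inE; apply/forallP=> x; apply/forallP=> y; rewrite !perm1.
rewrite !inE => /forallP Hs /forallP Ht.
apply/forallP=> x; apply/forallP=> y; rewrite !permM.
by rewrite (eqP (forallP (Ht _) _)) (forallP (Hs x) y).
Qed.

Canonical graph_aut_group := Group graph_aut_group_set.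

End GraphAutomorphisms.

Section LeviGraph.
Variables (pt ln : finType) (inc : pt -> ln -> bool).

Definition levi : rel (pt + ln) := fun u v =>
  match u, v with
  | inl p, inr l => inc p l
  | inr l, inl p => inc p l
  | _, _ => false
  end.

Lemma levi_sym : symmetric levi.
Proof. by case=> [?|?] [?|?]. Qed.

Lemma levi_irrefl : irreflexive levi.
Proof. by case. Qed.

End LeviGraph.

(* mk: Moebius-Kantor configuration; fano: Fano configuration.  Lines are      *)
(* capitalised, L_i, L'_i, L''_i, except d_0, d_1 and d; indices are mod 4.    *)
Inductive mk_point := P of 'Z_4 | P' of 'Z_4.
Inductive mk_line := L of 'Z_4 | L' of 'Z_4.
Inductive fano_point := P'' of 'Z_4 | D0 | D1 | Q.
Inductive fano_line := L'' of 'Z_4 | d0 | d1 | d.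

Definition mk_point_code (p : mk_point) : 'Z_4 + 'Z_4 :=
  match p with P i => inl i | P' i => inr i end.
Definition mk_point_decode (c : 'Z_4 + 'Z_4) : mk_point :=
  match c with inl i => P i | inr i => P' i end.
Lemma mk_point_codeK : cancel mk_point_code mk_point_decode.
Proof. by case. Qed.
HB.instance Definition _ := Finite.copy mk_point (can_type mk_point_codeK).

Definition mk_line_code (l : mk_line) : 'Z_4 + 'Z_4 :=
  match l with L i => inl i | L' i => inr i end.
Definition mk_line_decode (c : 'Z_4 + 'Z_4) : mk_line :=
  match c with inl i => L i | inr i => L' i end.
Lemma mk_line_codeK : cancel mk_line_code mk_line_decode.
Proof. by case. Qed.
HB.instance Definition _ := Finite.copy mk_line (can_type mk_line_codeK).

Definition fano_point_code (p : fano_point) : 'Z_4 + option bool :=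
  match p with
  | P'' i => inl i
  | D0 => inr (Some false) | D1 => inr (Some true) | Q => inr None
  end.
Definition fano_point_decode (c : 'Z_4 + option bool) : fano_point :=
  match c with
  | inl i => P'' i
  | inr (Some false) => D0 | inr (Some true) => D1 | inr None => Q
  end.
Lemma fano_point_codeK : cancel fano_point_code fano_point_decode.
Proof. by case. Qed.
HB.instance Definition _ := Finite.copy fano_point (can_type fano_point_codeK).

Definition fano_line_code (l : fano_line) : 'Z_4 + option bool :=
  match l with
  | L'' i => inl i
  | d0 => inr (Some false) | d1 => inr (Some true) | d => inr None
  end.
Definition fano_line_decode (c : 'Z_4 + option bool) : fano_line :=
  match c with
  | inl i => L'' i
  | inr (Some false) => d0 | inr (Some true) => d1 | inr None => d
  end.
Lemma fano_line_codeK : cancel fano_line_code fano_line_decode.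
Proof. by case. Qed.
HB.instance Definition _ := Finite.copy fano_line (can_type fano_line_codeK).

Section Goedgebeur.
Local Open Scope ring_scope.

Definition mk_points_on (l : mk_line) : seq mk_point :=
  match l with
  | L i => [:: P' i; P' (i + 1); P (i + 2)]
  | L' i => [:: P' i; P (i - 1); P i]
  end.

Definition mk_removed (p : mk_point) (l : mk_line) : bool :=
  match p, l with
  | P i, L j => j == i + 2
  | _, _ => false
  end.

Definition mk_residue (p : mk_point) (l : mk_line) : bool :=
  (p \in mk_points_on l) && ~~ mk_removed p l.

Definition fano_points_on (l : fano_line) : seq fano_point :=
  match l with
  | L'' i => [:: P'' i; P'' (i + 1); if odd i then D1 else D0]
  | d0 => [:: P'' 0; P'' 2; Q]
  | d1 => [:: P'' 1; P'' 3; Q]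
  | d => [:: D0; D1; Q]
  end.

Definition fano_removed (p : fano_point) (l : fano_line) : bool :=
  match p, l with
  | P'' j, L'' i => j == i + 1
  | _, _ => false
  end.

Definition fano_residue (p : fano_point) (l : fano_line) : bool :=
  (p \in fano_points_on l) && ~~ fano_removed p l.

Definition goedgebeur_point : finType := (mk_point + fano_point)%type.
Definition goedgebeur_line : finType := (mk_line + fano_line)%type.

Definition goedgebeur_inc (p : goedgebeur_point) (l : goedgebeur_line) : bool :=
  match p, l with
  | inl p, inl l => mk_residue p l
  | inr p, inr l => fano_residue p l
  | inl (P i), inr (L'' j) => i == j
  | inr (P'' i), inl (L j) => i == j
  | _, _ => false
  end.

Definition goedgebeur_graph : rel (goedgebeur_point + goedgebeur_line) :=
  levi goedgebeur_inc.

Definition goedgebeur_points_on (l : goedgebeur_line) : seq goedgebeur_point :=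
  match l with
  | inl (L i) => [:: inl (P' i); inl (P' (i + 1)); inr (P'' i)]
  | inl (L' i) => [:: inl (P' i); inl (P (i - 1)); inl (P i)]
  | inr (L'' i) => [:: inr (P'' i); inl (P i); inr (if odd i then D1 else D0)]
  | inr d0 => [:: inr (P'' 0); inr (P'' 2); inr Q]
  | inr d1 => [:: inr (P'' 1); inr (P'' 3); inr Q]
  | inr d => [:: inr D0; inr D1; inr Q]
  end.

Lemma goedgebeur_incE p l : goedgebeur_inc p l = (p \in goedgebeur_points_on l).
Proof.
have Z4 (A : 'Z_4 -> Prop) : A 0 -> A 1 -> A 2 -> A 3 -> forall i, A i.
  move=> A0 A1 A2 A3 [[|[|[|[|//]]]] lt_i].
  - by rewrite (_ : Ordinal lt_i = 0) //; apply: val_inj.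
  - by rewrite (_ : Ordinal lt_i = 1) //; apply: val_inj.
  - by rewrite (_ : Ordinal lt_i = 2) //; apply: val_inj.
  - by rewrite (_ : Ordinal lt_i = 3) //; apply: val_inj.
by case: p => [[]|[]]; case: l => [[]|[]]; do 2?[elim/Z4]; vm_compute.
Qed.

End Goedgebeur.

(* Main.v *)
(* Subdivide the nine edges of K_{3,3}, take two copies of the result, and     *)
(* join each subdivision vertex to its copy: this is Goedgebeur's graph.       *)
(* Aut(K_{3,3}) = S_3 wr Z_2 = (Z_3 x Z_3) : D_4 acts on both copies at once,  *)
(* Z_3 x Z_3 by shifting rows and columns and D_4 by transposing and negating, *)
(* and interchanging the copies commutes with this action.  These 144          *)
(* automorphisms are all of them: the partial automorphisms are enumerated by  *)
(* a backtracking search.                                                      *)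

Require Import Defs.
From mathcomp Require Import all_boot all_order all_algebra all_fingroup all_solvable.

Set Implicit Arguments.
Unset Strict Implicit.
Unset Printing Implicit Defensive.

Import GRing.Theory.

(** Let H be K_{3,3} with its nine edges subdivided and a loop added at each subdivision vertex. The
    graph is the direct product of H with K_2 ([model_adjE]), so every automorphism of H acts on it,
    and so does the exchange of the two sides, which commutes with that action. The shifts form a
    subgroup of order 9, normalised by the transposition, the negation of rows and the exchange;
    these three generate a complement of order 16 ([model_complement]). This makes 144
    automorphisms, and an exhaustive search bounds their number by 144 ([card_model_aut_le]), whence
    [model_aut_sdprod]. The result is carried to Goedgebeur's graph by an explicit isomorphism
    ([goedgebeur_to_model_adj]), and from an internal to an external semidirect product by
    [isog_sdprod_by]. *)

(** * Recognising semidirect products and dihedral groups *)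

Section ExternalSemidirectProduct.
Local Open Scope group_scope.
Variables (gT rT aT : finGroupType) (G N K : {group gT}).

(** The action is conjugation of [N] by [K], pulled back along the two isomorphisms. *)
Lemma isog_sdprod_by :
    N ><| K = G -> [set: rT] \isog N -> [set: aT] \isog K ->
  exists to : groupAction [set: aT] [set: rT], G \isog [set: sdprod_by to].
Proof.
move=> defG /isogP[f injf imf] /isogP[g injg img].
have [_ defNK nNK tiNK] := sdprodP defG.
have fgN x a : f x ^ g a \in f @* [set: rT].
  by rewrite imf memJ_norm ?(subsetP nNK) // -?imf -?img mem_morphim.
pose act x a := invm injf (f x ^ g a).
have f_act x a : f (act x a) = f x ^ g a by rewrite invmK.
have act_inj : left_injective act.
  move=> a x y /(congr1 f); rewrite !f_act => /conjg_inj.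
  by move/(injmP injf); apply; rewrite inE.
have act_is_action : is_action [set: aT] act.
  split=> // x a b _ _; apply: (injmP injf); rewrite ?inE //.
  by rewrite !f_act morphM ?inE // conjgM.
pose to0 := Action act_is_action.
have to_is_gact : is_groupAction [set: rT] to0.
  move=> a _; rewrite inE; apply/andP; split.
    by apply/subsetP=> x; rewrite inE.
  apply/morphicP=> x y _ _; rewrite !actpermE /=.
  apply: (injmP injf); rewrite ?inE // morphM ?inE // !f_act morphM ?inE //.
  by rewrite conjMg.
pose to : groupAction [set: aT] [set: rT] := GroupAction to_is_gact.
exists to; rewrite isog_sym.
have fg_act : {in [set: rT] & [set: aT], morph_act to 'J f g}.
  by move=> x a _ _; rewrite /= -f_act.
apply/isogP; exists (xsdprod_morphism fg_act) => /=; last first.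
  by rewrite im_xsdprodm imf img.
by rewrite injm_xsdprodm injf injg imf img tiNK eqxx.
Qed.

End ExternalSemidirectProduct.

Lemma isog_dihedral (gT : finGroupType) (q : nat) (r t : gT) :
    (2 < q)%N -> #[r]%g = q -> (t ^+ 2 = 1 -> r ^ t = r^-1 ->
  [set: 'D_(q.*2)] \isog <[r]> <*> <[t]>)%g.
Proof.
move=> q_gt2 or t2 rt; have q_gt1 := ltnW q_gt2.
have r't: (t \notin <[r]>)%g.
  (* If [t] were a power of [r], it would commute with [r]; then [r] would equal its inverse and [q]
     would divide 2. *)
  apply: contraL (q_gt2) => /cycleP[i t_ri]; rewrite -leqNgt dvdn_leq //.
  rewrite -or order_dvdn expgS expg1 -eq_invg_mul -rt t_ri.
  by rewrite conjgE -expgS expgSr mulKg.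
have ot: #[t]%g = 2.
  by apply: nt_prime_order => //; apply: contraNneq r't => ->.
have nrt: (<[t]> \subset 'N(<[r]>))%g.
  by rewrite cycle_subG inE -cycleJ rt cycleV.
have tirt: (<[r]> :&: <[t]> = 1)%g.
  by rewrite setIC prime_TIg -?orderE ?ot // cycle_subG.
rewrite isog_sym; apply/(isoGrpP _ (Grp_dihedral q_gt1)); split.
  by rewrite card_dihedral //= norm_joinEr // TI_cardMg // -!orderE or ot muln2.
apply/existsP; exists (r, t); rewrite /= !xpair_eqE eqxx /=.
by rewrite rt t2 -or expg_order !eqxx.
Qed.

(** * Graph automorphisms and their transport along isomorphisms *)

Lemma graph_autP (V : finType) (adj : rel V) (s : {perm V}) :
  reflect (forall x y, adj (s x) (s y) = adj x y) (s \in graph_aut adj).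
Proof.
rewrite inE; apply: (iffP forallP) => [sP x y | sP x].
  exact/eqP/(forallP (sP x)).
by apply/forallP=> y; rewrite sP.
Qed.

Section GraphIsomorphism.
Local Open Scope group_scope.
Variables (V V' : finType) (adj : rel V) (adj' : rel V').

Lemma isog_graph_aut (f : V -> V') :
    bijective f -> (forall x y, adj' (f x) (f y) = adj x y) ->
  graph_aut adj \isog graph_aut adj'.
Proof.
case=> g fK gK f_adj.
have g_adj x y : adj (g x) (g y) = adj' x y by rewrite -f_adj !gK.
have h_inj (s : {perm V}) : injective (f \o s \o g).
  by apply: inj_comp (can_inj gK); apply: inj_comp (can_inj fK) (@perm_inj _ s).
pose h s := perm (h_inj s).
have hM : {in graph_aut adj &, {morph h : s t / s * t}}.
  by move=> s t _ _; apply/permP=> x; rewrite permM !permE /= fK permM.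
apply/isogP; exists (Morphism hM).
  apply/injmP=> s t _ _ /permP/= eq_st; apply/permP=> x.
  by move: (eq_st (f x)); rewrite !permE /= fK => /(can_inj fK).
apply/setP=> t; apply/morphimP/idP=> [[s /graph_autP sP _ ->] | /graph_autP tP].
  by apply/graph_autP=> x y; rewrite !permE /= f_adj sP g_adj.
have k_inj : injective (g \o t \o f).
  by apply: inj_comp (can_inj fK); apply: inj_comp (can_inj gK) (@perm_inj _ t).
have aut_k : perm k_inj \in graph_aut adj.
  by apply/graph_autP=> x y; rewrite !permE /= g_adj tP f_adj.
by exists (perm k_inj) => //; apply/permP=> x; rewrite !permE /= permE /= !gK.
Qed.

End GraphIsomorphism.

(** * Bounding the number of automorphisms by a search *)

Section BacktrackingBound.
Variables (V : finType) (adj : rel V) (nbr : V -> seq V) (vs : seq V).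
Hypotheses (adjE : forall x y, adj x y = (y \in nbr x)).
Hypotheses (vsP : forall x, x \in vs).

(* [done] lists the argument-value pairs of a partial automorphism, to be      *)
(* extended to [todo]; a vertex with a neighbour already in the domain is only *)
(* sent to neighbours of the image, which keeps the search tree small.         *)
Fixpoint count_extensions (done : seq (V * V)) (todo : seq V) : nat :=
  if todo is v :: todo' then
    let candidates :=
      if [seq p <- done | v \in nbr p.1] is p :: _ then nbr p.2 else vs in
    let compatible w := all (fun p => ((w == p.2) == (v == p.1)) &&
                              ((w \in nbr p.2) == (v \in nbr p.1))) done in
    sumn [seq count_extensions ((v, w) :: done) todo'
         | w <- candidates & compatible w]
  else 1.

Lemma card_graph_aut_extending done todo :
    (forall v, v \in [seq p.1 | p <- done] ++ todo) ->
  #|[set s in graph_aut adj | all (fun p => s p.1 == p.2) done]|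
    <= count_extensions done todo.
Proof.
elim: todo done => [|v todo IHtodo] done; rewrite ?cats0 => doneP /=.
  apply/card_le1_eqP=> s t; rewrite !inE => /andP[_ /allP sP] /andP[_ /allP tP].
  apply/permP=> x; have /mapP[p p_done ->] := doneP x.
  by rewrite (eqP (sP p p_done)) (eqP (tP p p_done)).
set cs := [seq w <- _ | _].
pose A w := [set s in graph_aut adj |
              all (fun p => s p.1 == p.2) ((v, w) :: done)].
apply: (@leq_trans (\sum_(w <- cs) #|A w|)); last first.
  rewrite sumnE big_map; apply: leq_sum => w _; apply: IHtodo => x.
  by have:= doneP x; rewrite /= !(mem_cat, inE); case: (x == v); rewrite ?orbT.
apply: (@leq_trans #|\bigcup_(w <- cs) A w|); last first.
  elim: cs => [|w cs IHcs]; rewrite ?big_nil ?cards0 // !big_cons.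
  by apply: leq_trans (leq_card_setU _ _) _; rewrite leq_add2l.
apply: subset_leq_card; apply/subsetP=> s; rewrite inE => /andP[aut_s sP].
have s_adj x y : (s y \in nbr (s x)) = (y \in nbr x).
  by rewrite -!adjE (elimT (graph_autP _ _) aut_s).
suffices sv_cs : s v \in cs.
  by rewrite (big_rem _ sv_cs) inE [s \in A _]inE aut_s /= eqxx sP.
rewrite mem_filter; apply/andP; split.
  apply/allP=> p /(allP sP)/eqP <-.
  by rewrite s_adj eqxx (inj_eq perm_inj) eqxx.
(* If a neighbour of [v] already has an image, [s v] must be adjacent to that image; if not, every
   vertex is a candidate. *)
case def_ps: [seq p <- done | _] => [|p ps] //.
have: p \in p :: ps by rewrite mem_head.
by rewrite -def_ps mem_filter => /andP[vp /(allP sP)/eqP <-]; rewrite s_adj.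
Qed.

Lemma card_graph_aut_le : #|graph_aut adj| <= count_extensions [::] vs.
Proof.
apply: leq_trans (@card_graph_aut_extending [::] vs vsP).
by apply/subset_leq_card/subsetP=> s aut_s; rewrite in_set aut_s.
Qed.

End BacktrackingBound.

(** * The model graph on rows, columns and cells *)

Section Model.
Local Open Scope ring_scope.

(* The labels are the vertices (rows and columns) and the edges (cells) of     *)
(* K_{3,3}; a model vertex is a label together with a side of the bipartition. *)
Definition label := ('Z_3 + 'Z_3 + 'Z_3 * 'Z_3)%type.
Notation row u := (inl (inl u) : label).
Notation col w := (inl (inr w) : label).
Notation cell u w := (inr (u, w) : label).

Definition model := (bool * label)%type.

Definition Z3s : seq 'Z_3 := [:: 0; 1; -1].

Definition label_nbr (x : label) : seq label :=
  match x with
  | inl (inl u) => [seq cell u w | w <- Z3s]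
  | inl (inr w) => [seq cell u w | u <- Z3s]
  | inr (u, w) => [:: row u; col w; cell u w]
  end.

Definition model_nbr (v : model) : seq model :=
  [seq (~~ v.1, x) | x <- label_nbr v.2].

Definition model_adj : rel model := fun v w => w \in model_nbr v.

(** A symbolic form of [label_nbr], suited to checking symmetries by rewriting. Each cell is related
    to itself: this loop becomes the edge between its two copies. *)
Definition label_adj : rel label := fun x y =>
  match x, y with
  | inl (inl u), inr (u', _) | inr (u', _), inl (inl u) => u == u'
  | inl (inr w), inr (_, w') | inr (_, w'), inl (inr w) => w == w'
  | inr c, inr c' => c == c'
  | _, _ => false
  end.

Lemma Z3_ind (A : 'Z_3 -> Prop) : A 0 -> A 1 -> A (-1) -> forall u, A u.
Proof.
move=> A0 A1 A2 [[|[|[|//]]] lt_u].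
- by rewrite (_ : Ordinal lt_u = 0) //; apply: val_inj.
- by rewrite (_ : Ordinal lt_u = 1) //; apply: val_inj.
- by rewrite (_ : Ordinal lt_u = -1) //; apply: val_inj.
Qed.

Lemma Z4_ind (A : 'Z_4 -> Prop) : A 0 -> A 1 -> A 2 -> A 3 -> forall i, A i.
Proof.
move=> A0 A1 A2 A3 [[|[|[|[|//]]]] lt_i].
- by rewrite (_ : Ordinal lt_i = 0) //; apply: val_inj.
- by rewrite (_ : Ordinal lt_i = 1) //; apply: val_inj.
- by rewrite (_ : Ordinal lt_i = 2) //; apply: val_inj.
- by rewrite (_ : Ordinal lt_i = 3) //; apply: val_inj.
Qed.

Lemma label_nbrE x y : (y \in label_nbr x) = label_adj x y.
Proof.
by case: x y => [[u|w]|[u w]] [[u'|w']|[u' w']];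
   try elim/Z3_ind: u; try elim/Z3_ind: w; try elim/Z3_ind: u';
   try elim/Z3_ind: w'; vm_compute.
Qed.

Lemma model_adjE v w : model_adj v w = (v.1 != w.1) && label_adj v.2 w.2.
Proof.
case: v w => [s x] [s' y]; rewrite /= -label_nbrE; apply/mapP/andP => /=.
  by case=> z xz [-> ->]; case: (s).
by case=> neq xy; exists y => //; congr (_, _); case: s s' neq => [] [].
Qed.

(* Consecutive vertices are close together, to keep the search tree small.     *)
Definition model_vertices : seq model :=
  [seq (s, x) | x <- [:: cell 0 0; row 0; cell 0 1; cell 0 (-1);
                         col 0; col 1; col (-1); cell 1 0; row 1; cell (-1) 0;
                         row (-1); cell 1 1; cell 1 (-1); cell (-1) 1;
                         cell (-1) (-1)],
                s <- [:: false; true]].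

Lemma mem_model_vertices v : v \in model_vertices.
Proof.
by case: v => [[] [[u|w]|[u w]]];
   try elim/Z3_ind: u; try elim/Z3_ind: w; vm_compute.
Qed.

Lemma card_model_aut_le : (#|graph_aut model_adj| <= 144)%N.
Proof.
have adjE x y : model_adj x y = (y \in model_nbr x) by [].
apply: leq_trans (card_graph_aut_le adjE mem_model_vertices) _.
by vm_compute.
Qed.

(** * Symmetries of the model *)

Definition label_map (f : label -> label) (v : model) : model := (v.1, f v.2).

Lemma label_map_inj f : injective f -> injective (label_map f).
Proof. by move=> f_inj [s x] [s' x'] [-> /f_inj->]. Qed.

Lemma label_map_aut f (f_inj : injective f) :
    (forall x y, label_adj (f x) (f y) = label_adj x y) ->
  perm (label_map_inj f_inj) \in graph_aut model_adj.
Proof. by move=> fP; apply/graph_autP=> v w; rewrite !permE !model_adjE /= fP. Qed.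

Definition shift (c : 'Z_3 * 'Z_3) (x : label) : label :=
  match x with
  | inl (inl u) => row (u + c.1)
  | inl (inr w) => col (w + c.2)
  | inr (u, w) => cell (u + c.1) (w + c.2)
  end.

Definition transpose (x : label) : label :=
  match x with
  | inl (inl u) => col u
  | inl (inr w) => row w
  | inr (u, w) => cell w u
  end.

Definition negate_rows (x : label) : label :=
  match x with
  | inl (inl u) => row (- u)
  | inl (inr w) => col w
  | inr (u, w) => cell (- u) w
  end.

Definition swap_sides (v : model) : model := (~~ v.1, v.2).

Lemma shift_inj c : injective (shift c).
Proof.
apply: (can_inj (g := shift (- c.1, - c.2))).
by case=> [[u|w]|[u w]] /=; rewrite ?addrK.
Qed.

Lemma transpose_inj : injective transpose.
Proof. by apply: (can_inj (g := transpose)); case=> [[u|w]|[u w]]. Qed.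

Lemma negate_rows_inj : injective negate_rows.
Proof.
by apply: (can_inj (g := negate_rows)); case=> [[u|w]|[u w]] /=; rewrite ?opprK.
Qed.

Lemma swap_sides_inj : injective swap_sides.
Proof.
by apply: (can_inj (g := swap_sides)) => -[s x]; rewrite /swap_sides negbK.
Qed.

Definition shift_perm c := perm (label_map_inj (@shift_inj c)).
Definition transpose_perm := perm (label_map_inj transpose_inj).
Definition negate_rows_perm := perm (label_map_inj negate_rows_inj).
Definition swap_sides_perm := perm swap_sides_inj.

Lemma shift_perm_aut c : shift_perm c \in graph_aut model_adj.
Proof.
by apply: label_map_aut => [[[u|w]|[u w]]] [[u'|w']|[u' w']] //=;
   rewrite ?xpair_eqE ?(inj_eq (addIr _)).
Qed.

Lemma transpose_perm_aut : transpose_perm \in graph_aut model_adj.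
Proof.
by apply: label_map_aut => [[[u|w]|[u w]]] [[u'|w']|[u' w']] //=;
   rewrite !xpair_eqE andbC.
Qed.

Lemma negate_rows_perm_aut : negate_rows_perm \in graph_aut model_adj.
Proof.
by apply: label_map_aut => [[[u|w]|[u w]]] [[u'|w']|[u' w']] //=;
   rewrite ?xpair_eqE (inj_eq oppr_inj).
Qed.

Lemma swap_sides_perm_aut : swap_sides_perm \in graph_aut model_adj.
Proof.
apply/graph_autP=> v w; rewrite !permE !model_adjE /=.
by rewrite (inj_eq negb_inj).
Qed.

(** * The group that these symmetries generate *)

Local Open Scope group_scope.

Lemma shift_permM : {in [set: 'Z_3 * 'Z_3] &, {morph shift_perm : c c' / c * c'}}.
Proof.
move=> c c' _ _; apply/permP=> [[s x]]; rewrite permM !permE /label_map /=.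
by congr (_, _); case: x => [[u|w]|[u w]] /=; rewrite !addrA.
Qed.

Canonical shift_morphism := Morphism shift_permM.

Definition shift_group := shift_perm @* [set: 'Z_3 * 'Z_3].
Canonical shift_group_group := [group of shift_group].

Lemma isog_shift_group : [set: 'Z_3 * 'Z_3] \isog shift_group.
Proof.
apply: sub_isog => //; apply/injmP=> [[a b] [a' b']] _ _ /permP eq_sh.
have:= eq_sh (false, cell 0 0); rewrite !permE /label_map /=.
by rewrite !add0r => -[-> ->].
Qed.

(** The witness [c'] is the conjugate shift, so the uses below display the action of the complement
    on pairs of residues. *)
Lemma norm_shift_group (g : {perm model}) :
    (forall c, exists c', shift_perm c * g = g * shift_perm c') ->
  g \in 'N(shift_group).
Proof.
move=> gP; rewrite inE; apply/subsetP=> _ /imsetP[_ /morphimP[c _ _ ->] ->].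
have [c' eq_cg] := gP c.
by rewrite conjgE mulgA /= -mulgA eq_cg mulKg mem_morphim ?inE.
Qed.

Lemma transpose_norm : transpose_perm \in 'N(shift_group).
Proof.
apply: norm_shift_group => c; exists (c.2, c.1).
by apply/permP=> [[s [[u|w]|[u w]]]]; rewrite !permM !permE.
Qed.

Lemma negate_rows_norm : negate_rows_perm \in 'N(shift_group).
Proof.
apply: norm_shift_group => c; exists ((- c.1)%R, c.2).
by apply/permP=> [[s [[u|w]|[u w]]]]; rewrite !permM !permE /label_map /= ?opprD.
Qed.

Lemma swap_sides_norm : swap_sides_perm \in 'N(shift_group).
Proof.
by apply: norm_shift_group => c; exists c; apply/permP=> v; rewrite !permM !permE.
Qed.

(** A quarter turn of the grid: the cell (u, w) goes to (- w, u), so the square negates both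
    coordinates. *)
Definition rotation := transpose_perm * negate_rows_perm.

Lemma order_rotation : #[rotation] = 4%N.
Proof.
have r2 (x : label) s : (rotation ^+ 2) (s, x) =
    (s, match x with inl (inl u) => row (- u) | inl (inr w) => col (- w)
        | inr (u, w) => cell (- u) (- w) end).
  by case: x => [[u|w]|[u w]]; rewrite expgS expg1 !permM !permE.
apply: (@orderXprime _ 2 2) => //; apply: nt_prime_order => //.
  apply/permP=> [[s x]]; rewrite expgS expg1 permM !r2 perm1.
  by case: x => [[u|w]|[u w]]; rewrite !opprK.
by apply/eqP=> /permP/(_ (false, row 1%R)); rewrite r2 perm1 => /eqP.
Qed.

Lemma transposeV : transpose_perm^-1 = transpose_perm.
Proof.
apply/eqP; rewrite eq_invg_mul; apply/eqP; apply/permP.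
by case=> s [[u|w]|[u w]]; rewrite permM perm1 !permE.
Qed.

Lemma negate_rowsV : negate_rows_perm^-1 = negate_rows_perm.
Proof.
apply/eqP; rewrite eq_invg_mul; apply/eqP; apply/permP.
by case=> s [[u|w]|[u w]]; rewrite permM perm1 !permE /label_map /= ?opprK.
Qed.

Lemma swap_sidesV : swap_sides_perm^-1 = swap_sides_perm.
Proof.
apply/eqP; rewrite eq_invg_mul; apply/eqP; apply/permP.
by case=> s x; rewrite permM perm1 !permE /swap_sides negbK.
Qed.

Definition dihedral_group := (<[rotation]> <*> <[transpose_perm]>)%G.

Lemma isog_dihedral_group : [set: 'D_8] \isog dihedral_group.
Proof.
apply: (@isog_dihedral _ 4) => //; first exact: order_rotation.
  by rewrite expgS expg1 -{1}transposeV mulVg.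
by rewrite conjgE !mulgA mulVg mul1g invMg transposeV negate_rowsV.
Qed.

Lemma model_complement :
  [set: 'D_8 * 'Z_2] \isog dihedral_group <*> <[swap_sides_perm]>.
Proof.
have oz: #[swap_sides_perm] = 2%N.
  apply: nt_prime_order => //; first by rewrite expgS expg1 -{1}swap_sidesV mulVg.
  by apply/eqP=> /permP/(_ (false, row 0)); rewrite permE perm1 => /eqP.
(* Label maps preserve [S], one side of the bipartition, and the exchange does not; hence it lies
   outside the dihedral group. *)
pose S := [set v : model | v.1].
have side_label f (f_inj : injective f) : perm (label_map_inj f_inj) \in 'N(S | 'P).
  by rewrite !inE; apply/subsetP=> v; rewrite !inE /= apermE permE.
have sideD : dihedral_group \subset 'N(S | 'P).
  by rewrite join_subG !cycle_subG groupM ?side_label.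
have cent_label f (f_inj : injective f) :
    perm (label_map_inj f_inj) \in 'C(<[swap_sides_perm]>).
  by rewrite cent_cycle; apply/cent1P/permP=> [[s x]]; rewrite !permM !permE.
have defK : dihedral_group \x <[swap_sides_perm]> =
            (dihedral_group <*> <[swap_sides_perm]>).
  apply: dprodEY; first by rewrite centsC join_subG !cycle_subG groupM ?cent_label.
  rewrite setIC prime_TIg -?orderE ?oz // cycle_subG.
  apply/negP=> /(subsetP sideD)/(astabs_act (false, row 0)).
  by rewrite !inE /= apermE permE.
have <- : setX [set: 'D_8] [set: 'Z_2] = setT by apply/setP=> c; rewrite !inE.
apply: isog_dprod (setX_dprod _ _) defK _ _.
  rewrite isog_sym; apply: isog_trans (isog_setX1 _ _).
  by rewrite isog_sym isog_dihedral_group.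
rewrite isog_sym; apply: isog_trans (isog_set1X _ _).
rewrite isog_cyclic_card ?cycle_cyclic // -orderE oz cardsT card_ord eqxx andbT.
by apply/cyclicP; exists Zp1; exact: Zp_cycle.
Qed.

(** The orders 9 and 16 are coprime, so the product of the two subgroups has 144 elements, and the
    search bound leaves room for no other automorphism. *)
Lemma model_aut_sdprod :
  shift_group ><| (dihedral_group <*> <[swap_sides_perm]>) = graph_aut model_adj.
Proof.
have oN: #|shift_group| = 9%N.
  by rewrite -(card_isog isog_shift_group) cardsT card_prod !card_ord.
have oK: #|dihedral_group <*> <[swap_sides_perm]>| = 16%N.
  have oD8: #|[set: 'D_8]| = 8%N by apply: (@card_dihedral 4).
  by rewrite -(card_isog model_complement) cardsT card_prod -cardsT oD8 card_ord.
have sNG: shift_group \subset graph_aut model_adj.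
  by apply/subsetP=> _ /morphimP[c _ _ ->]; apply: shift_perm_aut.
have sKG: dihedral_group <*> <[swap_sides_perm]> \subset graph_aut model_adj.
  rewrite !join_subG !cycle_subG groupM ?swap_sides_perm_aut //=.
  - by rewrite transpose_perm_aut.
  - exact: transpose_perm_aut.
  - exact: negate_rows_perm_aut.
have nNK: dihedral_group <*> <[swap_sides_perm]> \subset 'N(shift_group).
  rewrite !join_subG !cycle_subG groupM ?swap_sides_norm //=.
  - by rewrite transpose_norm.
  - exact: transpose_norm.
  - exact: negate_rows_norm.
have tiNK: shift_group :&: (dihedral_group <*> <[swap_sides_perm]>) = 1.
  by apply: coprime_TIg; rewrite oN oK.
rewrite sdprodE //; apply/eqP; rewrite eqEcard mul_subG //=.
by rewrite TI_cardMg // oN oK card_model_aut_le.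
Qed.

(** * Identification with Goedgebeur's graph *)

Local Open Scope ring_scope.

(* Under this labelling, which is the same for points and lines, the letters P *)
(* and D name rows and columns, and each of P', P'' and Q names the cell at    *)
(* which the row and the column incident with it meet.                         *)
Definition label_P (i : 'Z_4) : label :=
  nth (row 0) [:: col 1; row (-1); col (-1); row 1] i.
Definition label_P' (i : 'Z_4) : label :=
  nth (row 0) [:: cell 1 1; cell (-1) 1; cell (-1) (-1); cell 1 (-1)] i.
Definition label_P'' (i : 'Z_4) : label :=
  nth (row 0) [:: cell 0 1; cell (-1) 0; cell 0 (-1); cell 1 0] i.

(** Through this map, exchanging the sides is the polarity of the configuration that matches each P
    with the L of the same index and primes, and [D0], [D1], [Q] with [d0], [d1], [d]. *)
Definition goedgebeur_to_model (v : goedgebeur_point + goedgebeur_line) : model :=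
  match v with
  | inl (inl (P i)) => (false, label_P i)
  | inl (inl (P' i)) => (false, label_P' i)
  | inl (inr (P'' i)) => (false, label_P'' i)
  | inl (inr D0) => (false, row 0)
  | inl (inr D1) => (false, col 0)
  | inl (inr Q) => (false, cell 0 0)
  | inr (inl (L i)) => (true, label_P i)
  | inr (inl (L' i)) => (true, label_P' i)
  | inr (inr (L'' i)) => (true, label_P'' i)
  | inr (inr d0) => (true, row 0)
  | inr (inr d1) => (true, col 0)
  | inr (inr d) => (true, cell 0 0)
  end.

Lemma goedgebeur_to_model_inj : injective goedgebeur_to_model.
Proof.
move=> v w eq_vw; apply/eqP; move/eqP: eq_vw; apply: implyP.
case: v => [[[]|[]]|[[]|[]]]; case: w => [[[]|[]]|[[]|[]]];
  by do 2?[elim/Z4_ind]; vm_compute.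
Qed.

Lemma goedgebeur_to_model_bij : bijective goedgebeur_to_model.
Proof.
apply: inj_card_bij goedgebeur_to_model_inj _.
have card_code (T T' : finType) (f : T -> T') g :
    cancel f g -> cancel g f -> #|T| = #|T'|.
  by move=> fK gK; apply: bij_eq_card; exists g.
have [oP oL]: #|{: mk_point}| = 8 /\ #|{: mk_line}| = 8.
  by split; [rewrite (card_code _ _ _ _ mk_point_codeK) |
             rewrite (card_code _ _ _ _ mk_line_codeK)];
     rewrite ?card_sum ?card_ord //; case.
have [oP' oL']: #|{: fano_point}| = 7 /\ #|{: fano_line}| = 7.
  by split; [rewrite (card_code _ _ _ _ fano_point_codeK) |
             rewrite (card_code _ _ _ _ fano_line_codeK)];
     rewrite ?card_sum ?card_option ?card_bool ?card_ord //; case=> [|[[]|]].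
by rewrite card_prod !card_sum card_prod card_bool !card_ord oP oL oP' oL'.
Qed.

Lemma goedgebeur_to_model_adj v w :
  model_adj (goedgebeur_to_model v) (goedgebeur_to_model w) = goedgebeur_graph v w.
Proof.
case: v => [[[]|[]]|[[]|[]]]; case: w => [[[]|[]]|[[]|[]]];
  by do 2?[elim/Z4_ind]; vm_compute.
Qed.

End Model.

Theorem theorem3p1 :
  exists to : groupAction [set: 'D_8 * 'Z_2] [set: 'Z_3 * 'Z_3],
    (graph_aut goedgebeur_graph \isog [set: sdprod_by to])%g.
Proof.
have [to isoG] := isog_sdprod_by model_aut_sdprod isog_shift_group model_complement.
exists to; apply: isog_trans isoG.
exact: isog_graph_aut goedgebeur_to_model_bij goedgebeur_to_model_adj.
Qed.
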